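(* Let $X$ be a set, $\alpha\in(0,1)$, $I$ a nonempty finite set, and $(f_i)_{i\in I}$, $f_i:X\to X$, a family of functions having attractor. If there exists $x_0\in X$ such that $f_i(x_0)=x_0$ for every $i\in I$, then there exists a complete and bounded metric $d$ on $X$ such that $d(f_i(x),f_i(y))\le\alpha\, d(x,y)$ for every $x,y\in X$ and every $i\in I$.
   Context: $\mathbb{N}=\{0,1,2,\dots\}$ and $\mathbb{N}^*=\{1,2,\dots\}$. $\Lambda(I)=I^{\mathbb{N}^*}$ is the set of infinite words $\omega=\omega_1\omega_2\dots$ with letters in $I$. For $\omega\in\Lambda(I)$ and $n\in\mathbb{N}$, $[\omega]_n=\omega_1\dots\omega_n$ if $n\ge 1$, and $[\omega]_0=\lambda$ (the empty word). Put $f_\lambda=\mathrm{Id}_X$, $f_{\omega_1\dots\omega_m}=f_{\omega_1}\circ\dots\circ f_{\omega_m}$, and $X_\omega=f_\omega(X)$ for every finite word $\omega$. Family having attractor: a family $(f_i)_{i\in I}$ of functions $f_i:X\to X$ with $I$ finite has attractor if: (a) for every $\omega\in\Lambda(I)$ the set $\bigcap_{n\in\mathbb{N}}X_{[\omega]_n}$ has a unique element, denoted $a_\omega$; (b) if $\omega,\theta\in\Lambda(I)$ and $a_\omega\ne a_\theta$, then there exists $n_0\in\mathbb{N}$ such that $X_{[\omega]_{n_0}}\cap X_{[\theta]_{n_0}}=\emptyset$. *)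

(* Defs.v *)
From HB Require Import structures.
From mathcomp Require Import all_boot all_order all_algebra.
From mathcomp Require Import boolp classical_sets reals topology metric_structure.

Set Implicit Arguments.
Unset Strict Implicit.
Unset Printing Implicit Defensive.

Local Open Scope classical_set_scope.
Local Open Scope ring_scope.

Section words.
Variables (X : Type) (I : finType) (f : I -> X -> X).

Definition fword (s : seq I) : X -> X := foldr (fun i g => f i \o g) id s.

Definition Xword (s : seq I) : set X := range (fword s).

(* An infinite word omega_1 omega_2 ... is a function w : nat -> I with
   w k = omega_(k+1); its prefix of length n is then mkseq w n. *)
Definition is_word_point (w : nat -> I) (a : X) : Prop :=
  \bigcap_n Xword (mkseq w n) = [set a].

Definition has_attractor : Prop :=
  (forall w : nat -> I, exists a : X, is_word_point w a) /\
  (forall (w t : nat -> I) (a b : X),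
     is_word_point w a -> is_word_point t b -> a <> b ->
     exists n0 : nat, Xword (mkseq w n0) `&` Xword (mkseq t n0) = set0).

End words.

(* The metrics on a bare type X, as instances of the metricType interface; the
   balls, uniformity and topology of such an instance are determined by mdist. *)
Definition metric_on (R : realType) (X : Type) : Type := Metric.axioms_ R X.

Definition metric_space (R : realType) (X : Type) (m : metric_on R X)
  : metricType R := Metric.Pack m.

Definition dist (R : realType) (X : Type) (m : metric_on R X) (x y : X) : R :=
  @mdist R (metric_space m) x y.

(* Same condition as in completeType, which would also require X to be
   equipped with a distinguished point. *)
Definition complete_metric (R : realType) (X : Type) (m : metric_on R X) : Prop :=
  forall F : set_system (metric_space m), ProperFilter F -> cauchy F ->
    exists l : metric_space m, F --> l.

Definition bounded_metric (R : realType) (X : Type) (m : metric_on R X) : Prop :=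
  exists C : R, forall x y : X, dist m x y <= C.

(* Main.v *)
Require Import Defs.
From mathcomp Require Import all_boot all_order all_algebra.
From mathcomp Require Import boolp classical_sets reals topology metric_structure.
From HB Require Import structures.

(** The common fixed point x0 lies in X_s for every finite word s, so the point
    of every infinite word is x0.  Hence a point x other than x0 leaves the
    decreasing sets X_[w]_n along every infinite word w, and since the alphabet
    is finite, Koenig's lemma (word_of_deep_point) makes this uniform: x lies in
    no X_s with s long enough.  Let n(x) be the least length n such that no X_s
    with s of length n contains x, and put h(x) = alpha ^ n(x), h(x0) = 0.

    If f_i x lies in no X_s with |s| = n + 1 then x lies in no X_s with |s| = n,
    because f_i (X_s) = X_(i s).  So n(f_i x) > n(x) unless f_i x = x0, that is,
    h (f_i x) <= alpha * h x (depth_weight_contracts).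

    The metric is the one in which distinct points x and y are at distance
    max (h x, h y), as if every path between them had to pass through the hub
    x0, with the larger leg counted.  The contraction of h passes to it.  It is
    complete because a set of small diameter that has two points lies near x0,
    so a Cauchy filter either converges to x0 or contains a singleton
    (radial_complete). *)

Set Implicit Arguments.
Unset Strict Implicit.
Unset Printing Implicit Defensive.

Import Order.TTheory GRing.Theory Num.Theory.

Local Open Scope classical_set_scope.
Local Open Scope ring_scope.

(** * Metrics from distance functions *)

Section metric_of_distance.
Variables (R : realType) (X : Type) (d : X -> X -> R).
Hypothesis dxx : forall x, d x x = 0.
Hypothesis d_pos : forall x y, d x y = 0 -> x = y.
Hypothesis d_sym : forall x y, d x y = d y x.
Hypothesis d_tri : forall y x z, d x z <= d x y + d y z.

(** A copy of X under a new name, so that the structures put on it are found by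
    inference from that name and from nothing else. *)
Let carrier : Type := X.
HB.instance Definition _ := gen_eqMixin carrier.
HB.instance Definition _ := gen_choiceMixin carrier.
HB.instance Definition _ :=
  @isMetric.Build R carrier d dxx d_pos d_sym d_tri.

Lemma metric_of_distance : exists m : metric_on R X, dist m = d.
Proof. by exists (Metric.class carrier). Qed.

End metric_of_distance.

(** * The distance through a hub *)

Section radial_distance.
Variables (R : realType) (X : Type) (h : X -> R).

Definition radial_dist (x y : X) : R :=
  if `[< x = y >] then 0 else Num.max (h x) (h y).

Lemma radial_dist_neq x y : x <> y -> radial_dist x y = Num.max (h x) (h y).
Proof. by rewrite /radial_dist; case: asboolP. Qed.

Lemma radial_distxx x : radial_dist x x = 0.
Proof. by rewrite /radial_dist; case: asboolP. Qed.

Hypothesis h_ge0 : forall x, 0 <= h x.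

Lemma radial_dist_le_max x y : radial_dist x y <= Num.max (h x) (h y).
Proof.
by rewrite /radial_dist; case: asboolP => // _; rewrite le_max h_ge0.
Qed.

Variable x0 : X.
Hypothesis h_eq0 : forall x, h x = 0 -> x = x0.

Lemma radial_metric : exists m : metric_on R X, dist m = radial_dist.
Proof.
apply: metric_of_distance => [|x y|x y|y x z].
- exact: radial_distxx.
- case: (pselect (x = y)) => // xy; rewrite radial_dist_neq// => max0.
  have h0 z : h z <= 0 -> z = x0.
    by move=> hz; apply: h_eq0; apply/le_anti; rewrite hz h_ge0.
  have -> : x = x0 by apply: h0; rewrite -max0 le_max lexx.
  by apply/esym/h0; rewrite -max0 le_max lexx orbT.
- case: (pselect (x = y)) => [->//|xy].
  by rewrite (radial_dist_neq xy) maxC radial_dist_neq// => /esym.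
- case: (pselect (x = y)) => [->|xy]; first by rewrite radial_distxx add0r.
  case: (pselect (y = z)) => [<-|yz]; first by rewrite radial_distxx addr0.
  apply: le_trans (radial_dist_le_max x z) _; rewrite !radial_dist_neq//.
  rewrite ge_max; apply/andP; split.
    by apply: ler_wpDr; rewrite le_max ?lexx ?h_ge0 ?orbT.
  by apply: ler_wpDl; rewrite le_max ?lexx ?h_ge0 ?orbT.
Qed.

Hypothesis h_x0 : h x0 = 0.

(** Either all balls around x0 are in the filter, or a radius for which this
    fails forces a set of that diameter in the filter to be a singleton. *)
Lemma radial_complete (m : metric_on R X) :
  dist m = radial_dist -> complete_metric m.
Proof.
move=> dm F PF cF.
have ballE (x y : metric_space m) e : ball x e y = (radial_dist x y < e).
  by rewrite ballEmdist -dm.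
case: (pselect (F --> (x0 : metric_space m))) => [Fx0|nFx0]; first by exists x0.
have [e e0 nFe] : exists2 e : R, 0 < e & ~ F (ball (x0 : metric_space m) e).
  apply: contrapT => nex; apply: nFx0 => A /nbhs_ballP[e /= e0 eA].
  apply: filterS eA _; apply: contrapT => nFe; apply: nex; by exists e.
have [[A B] /= [FA FB] AB] := (cauchy_ballP F).2 cF e e0.
have FAB : F (A `&` B) by exact: filterI.
have [l [Al Bl]] := filter_ex FAB.
exists l => C lC; apply: filterS FAB => y [Ay By].
case: (pselect (l = y)) => [<-|ly]; first exact: nbhs_singleton lC.
exfalso; apply: nFe.
have hball z : h z < e -> ball (x0 : metric_space m) e z.
  move=> hz; rewrite ballE; apply: le_lt_trans (radial_dist_le_max _ _) _.
  by rewrite h_x0 gt_max e0.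
have hl : h l < e.
  have /= := AB (l, y) (conj Al By).
  by rewrite ballE radial_dist_neq// gt_max => /andP[].
apply: filterS FA => a Aa; apply: hball.
case: (pselect (a = l)) => [->//|al].
have /= := AB (a, l) (conj Aa Bl).
by rewrite ballE radial_dist_neq// gt_max => /andP[].
Qed.

Lemma radial_contraction (alpha : R) (g : X -> X) : 0 <= alpha ->
  (forall x, h (g x) <= alpha * h x) ->
  forall x y, radial_dist (g x) (g y) <= alpha * radial_dist x y.
Proof.
move=> a0 hg x y; case: (pselect (x = y)) => [->|xy].
  by rewrite !radial_distxx mulr0.
rewrite (radial_dist_neq xy) maxr_pMr//.
apply: le_trans (radial_dist_le_max _ _) _.
by rewrite ge_max !le_max !hg orbT.
Qed.

End radial_distance.

(** * Depth of a point in the sets of finite words *)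

Section depth.
Variables (X : Type) (I : finType) (f : I -> X -> X).

Lemma Xword_cat s t : Xword f (s ++ t) `<=` Xword f s.
Proof.
have fword_cat y : fword f (s ++ t) y = fword f s (fword f t y).
  by elim: s => //= i s; rewrite /fword /= => ->.
by move=> _ [y _ <-]; exists (fword f t y).
Qed.

Lemma Xword_cons i s x : Xword f s x -> Xword f (i :: s) (f i x).
Proof. by move=> [y _ <-]; exists y. Qed.

Lemma Xword_fixed x0 s : (forall i, f i x0 = x0) -> Xword f s x0.
Proof.
move=> fx0; elim: s => [|i s IHs]; first by exists x0.
by rewrite -(fx0 i); exact: Xword_cons.
Qed.

Definition has_depth (n : nat) (x : X) : Prop :=
  exists2 s : seq I, size s = n & Xword f s x.

(** Koenig's lemma: the words s with x in X_s form a finitely branching tree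
    closed under prefixes, and an infinite branch is built by staying among the
    words that have extensions of every length in the tree. *)
Lemma word_of_deep_point x :
  (forall n, has_depth n x) -> exists w, forall n, Xword f (mkseq w n) x.
Proof.
move=> xdeep.
pose deep s := forall n, exists2 t : seq I, size t = n & Xword f (s ++ t) x.
have deepS s : deep s -> exists i, deep (rcons s i).
  move=> sdeep; apply: contrapT => /forallNP nodeep.
  have /choice[N HN] : forall i, exists n : nat,
      forall t, size t = n -> ~ Xword f (rcons s i ++ t) x.
    move=> i; apply: contrapT => /forallNP badn; apply: (nodeep i) => n.
    by apply: contrapT => nt; apply: (badn n) => t tn tx; apply: nt; exists t.
  have [[//|i t] /= [tsize] tx] := sdeep (\max_i N i).+1.
  (* Cutting t at length N i, which is at most its length, gives a word that
     the choice of N i excludes. *)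
  apply: (HN i (take (N i) t)).
    by rewrite size_takel// tsize leq_bigmax.
  apply: (@Xword_cat _ (drop (N i) t)).
  by rewrite -catA cat_take_drop cat_rcons.
have deep0 : deep [::] by move=> n; exact: xdeep.
have [i0 _] := deepS _ deep0.
have /choice[g Hg] : forall s, exists i, deep s -> deep (rcons s i).
  move=> s; case: (pselect (deep s)) => [/deepS[i si]|nds]; first by exists i.
  by exists i0.
pose p n := iter n (fun s => rcons s (g s)) [::].
have pdeep n : deep (p n) by elim: n => //= n; exact: Hg.
exists (g \o p) => n.
have -> : mkseq (g \o p) n = p n.
  by elim: n => //= n IHn; rewrite mkseqS IHn.
by have [t _] := pdeep n 0; exact: Xword_cat.
Qed.

(** The branch of words containing x also contains x0, and it determines a
    single point. *)
Lemma deep_point_fixed x0 x : has_attractor f -> (forall i, f i x0 = x0) ->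
  (forall n, has_depth n x) -> x = x0.
Proof.
move=> [fpt _] fx0 /word_of_deep_point[w wx].
have [a aE] := fpt w.
have eqa y : (forall n, Xword f (mkseq w n) y) -> y = a.
  by move=> wy; have : [set a] y by rewrite -aE => n _; exact: wy.
by rewrite (eqa x wx) (eqa x0)// => n; exact: Xword_fixed.
Qed.

Variables (R : realType) (alpha : R).

Definition depth_weight (x : X) : R :=
  if pselect (exists n, `[< ~ has_depth n x >]) is left ex
  then alpha ^+ ex_minn ex else 0.

Hypotheses (alpha_gt0 : 0 < alpha) (alpha_le1 : alpha <= 1).

Lemma depth_weight_ge0 x : 0 <= depth_weight x.
Proof. by rewrite /depth_weight; case: pselect => // ex; exact/exprn_ge0/ltW. Qed.

Lemma depth_weight_le1 x : depth_weight x <= 1.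
Proof.
by rewrite /depth_weight; case: pselect => // ex; exact/exprn_ile1/alpha_le1/ltW.
Qed.

Lemma depth_weight_eq0 x : depth_weight x = 0 <-> forall n, has_depth n x.
Proof.
rewrite /depth_weight; case: pselect => [ex|nex]; split => //.
- by move=> /eqP; rewrite expf_eq0 (gt_eqF alpha_gt0) andbF.
- by have [n /asboolP nx] := ex; move=> /(_ n).
- move=> _ n; apply: contrapT => nx; apply: nex; exists n; exact/asboolP.
Qed.

(** If f_i x escapes every word of length n then n = k + 1, since X is the set of
    the empty word, and x already escapes every word of length k. *)
Lemma depth_weight_contracts i x :
  depth_weight (f i x) <= alpha * depth_weight x.
Proof.
have shallow n : ~ has_depth n (f i x) -> exists2 k, n = k.+1 & ~ has_depth k x.
  case: n => [[]|k nfx]; first by exists [::] => //; exists (f i x).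
  exists k => // -[s sk sx]; apply: nfx.
  by exists (i :: s); [rewrite /= sk|exact: Xword_cons].
rewrite {1}/depth_weight; case: pselect => [ex|_]; last first.
  exact: mulr_ge0 (ltW alpha_gt0) (depth_weight_ge0 _).
case: ex_minnP => n /asboolP /shallow[k -> kx] _.
rewrite exprS ler_pM2l// /depth_weight; case: pselect => [ex'|[]]; last first.
  by exists k; exact/asboolP.
case: ex_minnP => n' _ /(_ k (asboolT kx)) n'k.
by rewrite ler_wiXn2l// ltW.
Qed.

End depth.

Theorem proposition4p4 (R : realType) (X : Type) (alpha : R)
  (halpha0 : 0 < alpha) (halpha1 : alpha < 1)
  (I : finType) (hI : (0 < #|I|)%N) (f : I -> X -> X)
  (hf : has_attractor f)
  (hfix : exists x0 : X, forall i : I, f i x0 = x0) :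
  exists d : metric_on R X,
    complete_metric d /\ bounded_metric d /\
    (forall (x y : X) (i : I), dist d (f i x) (f i y) <= alpha * dist d x y).
Proof.
have [x0 fx0] := hfix.
pose h := depth_weight f alpha.
have h_ge0 : forall x, 0 <= h x by exact: depth_weight_ge0.
have h_eq0 x : h x = 0 -> x = x0.
  by move=> /(depth_weight_eq0 _ halpha0) /(deep_point_fixed hf fx0).
have h_x0 : h x0 = 0.
  apply/(depth_weight_eq0 _ halpha0) => n.
  (* A word of any length is needed, hence a letter. *)
  have /card_gt0P[i0 _] := hI.
  by exists (nseq n i0); [rewrite size_nseq|exact: Xword_fixed].
have [m mE] := radial_metric h_ge0 h_eq0.
exists m; split; first exact: (radial_complete h_ge0 h_x0 mE).
split=> [|x y i]; last first.
  rewrite mE; apply: (radial_contraction h_ge0 (ltW halpha0)) => z.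
  exact: depth_weight_contracts halpha0 (ltW halpha1) _ _.
exists 1 => x y; rewrite mE; apply: le_trans (radial_dist_le_max h_ge0 _ _) _.
by rewrite ge_max !depth_weight_le1 // ltW.
Qed.
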